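(* Let $f\colon[a,b]\to\mathbb{R}$ be Laplace integrable on $[a,b]$ and have the intermediate value (Darboux) property on $[a,b]$. Let $g\colon[a,b]\to\mathbb{R}$ be Laplace integrable on $[a,b]$ and non-negative, and suppose $fg$ is Laplace integrable on $[a,b]$. Then there is $\xi\in[a,b]$ with $\int_a^bfg=f(\xi)\int_a^bg$. In particular, $\int_a^bf=f(\xi)(b-a)$ for some $\xi\in[a,b]$.
   Context: Laplace integral on $[a,b]$: with lower/upper Laplace derivates $\underline{LD}_1F(x)$, $\overline{LD}_1F(x)$ being the minimum of the $\liminf$'s, resp. maximum of the $\limsup$'s, as $s\to\infty$ of $s^2\int_0^\delta e^{-st}[F(x+t)-F(x)]dt$ and $(-s^2)\int_0^\delta e^{-st}[F(x-t)-F(x)]dt$ (one-sided at endpoints), a major function of $f$ is a continuous $U$ with $\underline{LD}_1U\geqslant f$, $\underline{LD}_1U>-\infty$ everywhere on $[a,b]$, a minor function a continuous $V$ with $\overline{LD}_1V\leqslant f$, $\overline{LD}_1V<\infty$ everywhere, and $f$ is Laplace integrable if $\sup_V(V(b)-V(a))=\inf_U(U(b)-U(a))$ is finite, this value being $\int_a^bf$. *)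

(* Defs.v *)
From HB Require Import structures.
From mathcomp Require Import all_boot all_order all_algebra.
From mathcomp Require Import all_classical all_reals all_analysis.
Set Implicit Arguments. Unset Strict Implicit. Unset Printing Implicit Defensive.
Import Order.TTheory GRing.Theory Num.Theory.
Import numFieldNormedType.Exports.
Local Open Scope classical_set_scope.
Local Open Scope ring_scope.

Section Laplace.
Variable R : realType.
Local Notation mu := (@lebesgue_measure R).

Definition lap_right (F : R -> R) (x d s : R) : \bar R :=
  ((s ^+ 2)%:E * \int[mu]_(t in `[0%R, d]%classic) (expR (- (s * t)) * (F (x + t) - F x))%:E)%E.

Definition lap_left (F : R -> R) (x d s : R) : \bar R :=
  ((- s ^+ 2)%:E * \int[mu]_(t in `[0%R, d]%classic) (expR (- (s * t)) * (F (x - t) - F x))%:E)%E.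

Definition liminf_oo (phi : R -> \bar R) : \bar R := limf_einf phi (pinfty_nbhs R).
Definition limsup_oo (phi : R -> \bar R) : \bar R := limf_esup phi (pinfty_nbhs R).

(* Lower / upper Laplace derivates on [a,b]; the (immaterial) delta is taken
   as b - x on the right and x - a on the left; one-sided at the endpoints. *)
Definition lowerLD (a b : R) (F : R -> R) (x : R) : \bar R :=
  if x == a then liminf_oo (lap_right F x (b - x))
  else if x == b then liminf_oo (lap_left F x (x - a))
  else Order.min (liminf_oo (lap_right F x (b - x)))
                 (liminf_oo (lap_left F x (x - a))).

Definition upperLD (a b : R) (F : R -> R) (x : R) : \bar R :=
  if x == a then limsup_oo (lap_right F x (b - x))
  else if x == b then limsup_oo (lap_left F x (x - a))
  else Order.max (limsup_oo (lap_right F x (b - x)))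
                 (limsup_oo (lap_left F x (x - a))).

Definition major (a b : R) (f : R -> R) (U : R -> R) : Prop :=
  {within `[a, b], continuous U} /\
  forall x, x \in `[a, b] ->
    ((f x)%:E <= lowerLD a b U x)%E /\ (-oo < lowerLD a b U x)%E.

Definition minor (a b : R) (f : R -> R) (V : R -> R) : Prop :=
  {within `[a, b], continuous V} /\
  forall x, x \in `[a, b] ->
    (upperLD a b V x <= (f x)%:E)%E /\ (upperLD a b V x < +oo)%E.

Definition lap_upper (a b : R) (f : R -> R) : \bar R :=
  ereal_inf [set (U b - U a)%:E | U in major a b f].
Definition lap_lower (a b : R) (f : R -> R) : \bar R :=
  ereal_sup [set (V b - V a)%:E | V in minor a b f].

Definition laplace_integrable (a b : R) (f : R -> R) : Prop :=
  lap_lower a b f = lap_upper a b f /\ lap_upper a b f \is a fin_num.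

(* the Laplace integral \int_a^b f (meaningful when f is Laplace integrable) *)
Definition laplace_integral (a b : R) (f : R -> R) : R := fine (lap_upper a b f).

Definition darboux_on (a b : R) (f : R -> R) : Prop :=
  forall x y c, x \in `[a, b] -> y \in `[a, b] -> x <= y ->
    Num.min (f x) (f y) <= c <= Num.max (f x) (f y) ->
    exists2 z, z \in `[x, y] & f z = c.
End Laplace.

(* Main.v *)
(** The integral is positive because a continuous function with nonnegative
    lower Laplace derivate is nondecreasing. It moreover satisfies: if [h >= 0]
    has integral [0], then so has [p h] for every [p], however large, integrable
    or not (sum suitable multiples of major functions of [h] with tiny
    increments). Let [I] and [J] be the integrals of [f g] and [g]. If [J = 0],
    the latter fact with [h = g], [p = f] gives [I = 0]. If [J > 0] and [f]
    stayed above [c = I / J], then [h = (f - c) g >= 0] would have integral [0],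
    hence so would [g = h / (f - c)]. So [f] takes a value [<= c], likewise a
    value [>= c], and therefore the value [c] by the Darboux property. *)
Require Import Defs.
From HB Require Import structures.
From mathcomp Require Import all_boot all_order all_algebra.
From mathcomp Require Import all_classical all_reals all_analysis.
From mathcomp Require Import ring lra.
Import Order.TTheory GRing.Theory Num.Theory numFieldNormedType.Exports.
Local Open Scope classical_set_scope.
Local Open Scope ring_scope.

(** * The weighted Laplace transform over a bounded interval *)

Section LapTransform.
Context {R : realType}.
Implicit Types (F G : R -> R) (d s c : R).
Local Notation mu := (@lebesgue_measure R).

(** Real-valued common form of [lap_right] and [lap_left], with [G] an increment of the function at
    a point. For continuous [G] no information is lost in passing to reals. *)
Definition lap G d s : R :=
  s ^+ 2 * \int[mu]_(t in `[0, d]) (expR (- (s * t)) * G t).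

Lemma continuous_expRM s : continuous (fun t : R => expR (- (s * t))).
Proof.
move=> t; apply: continuous_comp; last exact: continuous_expR.
by apply: cvgN; apply: cvgM; [exact: cvg_cst|].
Qed.

Lemma integrable_itv F c d :
  continuous F -> mu.-integrable `[c, d] (EFin \o F).
Proof.
move=> cF; apply: continuous_compact_integrable; first exact: segment_compact.
exact: continuous_subspaceT.
Qed.

Lemma integrable_expRM {G} c d s : continuous G ->
  mu.-integrable `[c, d] (EFin \o (fun t => expR (- (s * t)) * G t)).
Proof.
move=> cG; apply: integrable_itv => t.
by apply: cvgM; [exact: continuous_expRM|exact: cG].
Qed.

Lemma eq_lap {F G d} s : {in `[0, d], F =1 G} -> lap F d s = lap G d s.
Proof.
by move=> FG; congr (_ * _); apply: eq_Rintegral => t /set_mem td; rewrite FG.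
Qed.

Lemma lapD F G d s : continuous F -> continuous G ->
  lap (F \+ G) d s = lap F d s + lap G d s.
Proof.
move=> cF cG; rewrite /lap -mulrDr -RintegralD //; [|exact: (integrable_expRM _ _ _ cF)|exact: (integrable_expRM _ _ _ cG)].
by congr (_ * _); apply: eq_Rintegral => t _; rewrite /= mulrDr.
Qed.

Lemma lapZ c G d s : continuous G -> lap (c \*o G) d s = c * lap G d s.
Proof.
move=> cG; rewrite /lap mulrCA -(RintegralZl c) //; last exact: (integrable_expRM _ _ _ cG).
by congr (_ * _); apply: eq_Rintegral => t _ /=; rewrite mulrCA.
Qed.

Lemma lap_ge0 G d s : (forall t, t \in `[0, d] -> 0 <= G t) -> 0 <= lap G d s.
Proof.
move=> G0; apply: mulr_ge0; first exact: sqr_ge0.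
by apply: Rintegral_ge0 => t td; rewrite mulr_ge0 ?expR_ge0 ?G0.
Qed.

Lemma EFin_lap G d s : continuous G ->
  (lap G d s)%:E =
  ((s ^+ 2)%:E * \int[mu]_(t in `[0%R, d]) (expR (- (s * t)) * G t)%:E)%E.
Proof.
move=> cG; rewrite /lap EFinM /Rintegral fineK //.
by apply: integrable_fin_num => //; exact: (integrable_expRM _ _ _ cG).
Qed.

(** An antiderivative of the integrand, scaled by [s ^+ 2], is [P] below. The value tends to 1 as
    [s] grows, whatever [d] is, so the identity has Laplace derivate 1. *)
Lemma lap_id d s : 0 < d -> 0 < s ->
  lap id d s = 1 - (1 + s * d) * expR (- (s * d)).
Proof.
move=> d0 s0.
pose P := fun t : R => (- (1 + s * t)) * expR (- (s * t)).
have dP (t : R) : is_derive t 1 P (s ^+ 2 * (expR (- (s * t)) * t)).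
  rewrite /P; apply: is_derive_eq; rewrite /GRing.scale /=; ring.
have cP : continuous P.
  move=> t; apply/differentiable_continuous/derivable1_diffP.
  by have [] := dP t.
have cid : continuous (id : R -> R) by move=> t; exact: cvg_id.
rewrite /lap -RintegralZl //; last exact: (integrable_expRM _ _ _ cid).
rewrite /Rintegral (@continuous_FTC2 _ _ P) //.
- by rewrite /P /= mulr0 addr0 oppr0 expR0; ring.
- apply: continuous_subspaceT => t; apply: cvgM; first exact: cvg_cst.
  by apply: cvgM; [exact: continuous_expRM|].
- split => [t _||].
  + by have [] := dP t.
  + exact/cvg_at_right_filter/cP.
  + exact/cvg_at_left_filter/cP.
- by move=> t _; rewrite derive1E; have [_ ->] := dP t.
Qed.

End LapTransform.

(** * Laplace derivates as eventual inequalities *)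

Section Derivates.
Context {R : realType}.
Implicit Types (F G U V : R -> R) (a b d k s c x : R).
Local Notation mu := (@lebesgue_measure R).

(** The liminf is a supremum of infima over neighbourhoods of infinity, so a strict inequality is
    witnessed by a single neighbourhood. *)
Lemma liminf_oo_gt (phi : R -> R) k :
  (k%:E < liminf_oo (EFin \o phi))%E -> \forall s \near +oo, k <= phi s.
Proof.
rewrite /liminf_oo limf_einfE => /ereal_sup_gt[_ [A /= nA <-] kA].
apply: filterS nA => s As; rewrite -lee_fin; apply: (le_trans (ltW kA)).
by apply: ereal_inf_lbound; exists s.
Qed.

Lemma limsup_ooN (phi : R -> R) :
  limsup_oo (EFin \o phi) = (- liminf_oo (EFin \o (fun s => - phi s)%R))%E.
Proof.
by rewrite /limsup_oo -[limf_esup _ _]oppeK -limf_einfN.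
Qed.

Definition rdiff F x t := F (x + t) - F x.
(** This orientation absorbs the minus sign of [lap_left], so that both sides of [x] are handled by
    the same [lap]. *)
Definition ldiff F x t := F x - F (x - t).

Lemma continuous_rdiff F x : continuous F -> continuous (rdiff F x).
Proof.
move=> cF t; apply: cvgB; last exact: cvg_cst.
apply: continuous_comp; last exact: cF.
by apply: cvgD; [exact: cvg_cst|exact: cvg_id].
Qed.

Lemma continuous_ldiff F x : continuous F -> continuous (ldiff F x).
Proof.
move=> cF t; apply: cvgB; first exact: cvg_cst.
apply: continuous_comp; last exact: cF.
by apply: cvgB; [exact: cvg_cst|exact: cvg_id].
Qed.

Lemma lap_rightE F x d : continuous F ->
  lap_right F x d = EFin \o lap (rdiff F x) d.
Proof.
by move=> cF; apply/funext => s /=; rewrite EFin_lap //; exact: continuous_rdiff.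
Qed.

Lemma lap_leftE F x d : continuous F ->
  lap_left F x d = EFin \o lap (ldiff F x) d.
Proof.
move=> cF; apply/funext => s /=.
have cG : continuous (fun t => F (x - t) - F x).
  move=> t; apply: cvgB; last exact: cvg_cst.
  apply: continuous_comp; last exact: cF.
  by apply: cvgB; [exact: cvg_cst|exact: cvg_id].
rewrite /lap_left EFinN mulNe -EFin_lap // -EFinN -mulN1r -lapZ //.
by congr EFin; apply: eq_lap => t _; rewrite /ldiff /=; ring.
Qed.

(** With [b - x] as delta, [F] is sampled only inside [[a, b]]; hence it may be replaced by a
    continuous extension to the line. *)
Lemma eq_in_lap_right a b F G x : {in `[a, b], F =1 G} -> x \in `[a, b] ->
  lap_right F x (b - x) = lap_right G x (b - x).
Proof.
move=> FG xab; apply/funext => s; congr (_ * _)%E; apply: eq_integral => t.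
move: xab; rewrite inE /= !in_itv /= => /andP[ax xb] /andP[t0 tb].
by rewrite !FG // in_itv /=; lra.
Qed.

Lemma eq_in_lap_left a b F G x : {in `[a, b], F =1 G} -> x \in `[a, b] ->
  lap_left F x (x - a) = lap_left G x (x - a).
Proof.
move=> FG xab; apply/funext => s; congr (_ * _)%E; apply: eq_integral => t.
move: xab; rewrite inE /= !in_itv /= => /andP[ax xb] /andP[t0 tb].
by rewrite !FG // in_itv /=; lra.
Qed.

Lemma eq_in_lowerLD a b F G x : {in `[a, b], F =1 G} -> x \in `[a, b] ->
  lowerLD a b F x = lowerLD a b G x.
Proof.
by move=> FG xab; rewrite /lowerLD (eq_in_lap_right _ _ _ _ _ FG xab)
  (eq_in_lap_left _ _ _ _ _ FG xab).
Qed.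

Lemma eq_in_upperLD a b F G x : {in `[a, b], F =1 G} -> x \in `[a, b] ->
  upperLD a b F x = upperLD a b G x.
Proof.
by move=> FG xab; rewrite /upperLD (eq_in_lap_right _ _ _ _ _ FG xab)
  (eq_in_lap_left _ _ _ _ _ FG xab).
Qed.

(** Reduces minor functions to major functions of the opposite function. *)
Lemma upperLDN a b F x : continuous F ->
  upperLD a b F x = (- lowerLD a b (\- F)%R x)%E.
Proof.
move=> cF; have cNF : continuous (\- F) by move=> t; apply: cvgN; exact: cF.
have rN : liminf_oo (lap_right (\- F) x (b - x)) =
          (- limsup_oo (lap_right F x (b - x)))%E.
  rewrite !lap_rightE // limsup_ooN oppeK; congr liminf_oo; apply/funext => s /=.
  rewrite -[- lap _ _ _]mulN1r -lapZ; last exact: continuous_rdiff.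
  by congr EFin; apply: eq_lap => t _; rewrite /rdiff /=; ring.
have lN : liminf_oo (lap_left (\- F) x (x - a)) =
          (- limsup_oo (lap_left F x (x - a)))%E.
  rewrite !lap_leftE // limsup_ooN oppeK; congr liminf_oo; apply/funext => s /=.
  rewrite -[- lap _ _ _]mulN1r -lapZ; last exact: continuous_ldiff.
  by congr EFin; apply: eq_lap => t _; rewrite /ldiff /=; ring.
by rewrite /upperLD /lowerLD rN lN -oppe_max; case: ifP => _; [|case: ifP => _];
  rewrite oppeK.
Qed.

Definition ev_lap_ge G d k := \forall s \near +oo, k <= lap G d s.

Lemma ev_lap_geD F G d k c : continuous F -> continuous G ->
  ev_lap_ge F d k -> ev_lap_ge G d c -> ev_lap_ge (F \+ G) d (k + c).
Proof.
move=> cF cG kF kG; rewrite /ev_lap_ge; near=> s.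
by rewrite lapD // lerD //; near: s.
Unshelve. all: by end_near. Qed.

Lemma ev_lap_geZ G d k c : continuous G -> 0 <= c ->
  ev_lap_ge G d k -> ev_lap_ge (c \*o G) d (c * k).
Proof.
move=> cG c0; apply: filterS => s ks; rewrite lapZ //.
exact: ler_wpM2l.
Qed.

Lemma eq_ev_lap_ge F G d k : {in `[0, d], F =1 G} ->
  ev_lap_ge F d k -> ev_lap_ge G d k.
Proof. by move=> FG; apply: filterS => s; rewrite (eq_lap s FG). Qed.

(* Real-valued stand-in for [lowerLD]: [LD_ge a b F x k] follows from
   [k < lowerLD a b F x] and implies [k <= lowerLD a b F x]. *)
Definition LD_ge a b F x k :=
  (x < b -> ev_lap_ge (rdiff F x) (b - x) k) /\
  (a < x -> ev_lap_ge (ldiff F x) (x - a) k).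

Lemma lowerLD_gt a b F x k : continuous F -> x \in `[a, b] ->
  (k%:E < lowerLD a b F x)%E -> LD_ge a b F x k.
Proof.
move=> cF; rewrite in_itv /= => /andP[ax xb].
rewrite /lowerLD lap_rightE // lap_leftE //.
case: eqVneq => [xa|xa].
  by move=> /liminf_oo_gt ?; split => //; rewrite xa ltxx.
case: eqVneq => [xb'|xb'].
  by move=> /liminf_oo_gt ?; split => //; rewrite xb' ltxx.
by rewrite lt_min => /andP[/liminf_oo_gt ? /liminf_oo_gt ?]; split.
Qed.

Lemma LD_ge_le a b F x k c : c <= k -> LD_ge a b F x k -> LD_ge a b F x c.
Proof.
move=> ck [rF lF]; split=> [/rF|/lF]; apply: filterS => s; exact: le_trans.
Qed.

Lemma LD_geD a b F G x k c : continuous F -> continuous G ->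
  LD_ge a b F x k -> LD_ge a b G x c -> LD_ge a b (F \+ G) x (k + c).
Proof.
move=> cF cG [rF lF] [rG lG]; split=> [xb|ax].
- apply: (@eq_ev_lap_ge (rdiff F x \+ rdiff G x)).
    by move=> t _; rewrite /rdiff /=; ring.
  by apply: ev_lap_geD; [exact: continuous_rdiff..|exact: rF|exact: rG].
- apply: (@eq_ev_lap_ge (ldiff F x \+ ldiff G x)).
    by move=> t _; rewrite /ldiff /=; ring.
  by apply: ev_lap_geD; [exact: continuous_ldiff..|exact: lF|exact: lG].
Qed.

Lemma LD_geZ a b F x k c : continuous F -> 0 <= c ->
  LD_ge a b F x k -> LD_ge a b (c \*o F) x (c * k).
Proof.
move=> cF c0 [rF lF]; split=> [xb|ax].
- apply: (@eq_ev_lap_ge (c \*o rdiff F x)).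
    by move=> t _; rewrite /rdiff /=; ring.
  by apply: ev_lap_geZ; [exact: continuous_rdiff|done|exact: rF].
- apply: (@eq_ev_lap_ge (c \*o ldiff F x)).
    by move=> t _; rewrite /ldiff /=; ring.
  by apply: ev_lap_geZ; [exact: continuous_ldiff|done|exact: lF].
Qed.

Lemma eq_in_LD_ge a b F G x k : {in `[a, b], F =1 G} -> x \in `[a, b] ->
  LD_ge a b F x k -> LD_ge a b G x k.
Proof.
move=> FG xab [rF lF]; have := xab; rewrite in_itv /= => /andP[ax xb].
split=> [/rF|/lF]; apply: eq_ev_lap_ge => t; rewrite in_itv /= => /andP[t0 tb];
  by rewrite /rdiff /ldiff !FG // in_itv /=; lra.
Qed.

Lemma LD_ge_nondecreasing a b F x : x \in `[a, b] ->
  {in `[a, b] &, {homo F : y z / y <= z}} -> LD_ge a b F x 0.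
Proof.
rewrite in_itv /= => /andP[ax xb] ndF; split=> _; apply: nearW => s;
  apply: lap_ge0 => t; rewrite in_itv /= subr_ge0 => /andP[t0 tb];
  by apply: ndF; rewrite ?in_itv /=; lra.
Qed.

Lemma mulr_expRN_near_le (d e : R) : 0 < d -> 0 < e ->
  \forall s \near +oo, (1 + s * d) * expR (- (s * d)) <= e.
Proof.
move=> d0 e0; near=> s.
have s0 : 0 < s by near: s; exact: nbhs_pinfty_gt.
have y0 : 0 < s * d by rewrite mulr_gt0.
rewrite expRN ler_pdivrMr ?expR_gt0 //.
have := @expR_ge1Dxn _ (s * d) 1 (ltW y0); rewrite (_ : 2`!%:R = 2) // => h.
apply: le_trans (ler_wpM2l (ltW e0) h).
(* From this threshold on, [e / 2 * y ^+ 2] dominates [1 + y] for [y = s * d], while the exponential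
   dominates [1 + y ^+ 2 / 2]. *)
have : 1 + 2 / e <= s * d by rewrite -ler_pdivrMr //; near: s; exact: nbhs_pinfty_ge.
set y := s * d => ey.
suff : 1 + y <= e / 2 * y ^+ 2 by nra.
have := ler_wpM2l (ltW e0) ey; rewrite mulrDr mulr1 mulrCA divff ?gt_eqF // mulr1 => ey'.
have := ler_wpM2l (ltW y0) ey'; rewrite -/y; nra.
Unshelve. all: by end_near. Qed.

(** The transform is 1 minus a positive term tending to 0: it eventually passes every [k < 1] but
    never reaches 1. *)
Lemma LD_ge_id a b x k : k < 1 -> LD_ge a b id x k.
Proof.
move=> k1.
have H d : 0 < d -> ev_lap_ge id d k.
  move=> d0; rewrite /ev_lap_ge; near=> s.
  have s0 : 0 < s by near: s; exact: nbhs_pinfty_gt.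
  rewrite lap_id //.
  rewrite lerBrDr -lerBrDl; near: s; apply: mulr_expRN_near_le => //.
  by rewrite subr_gt0.
split=> xd; (apply: eq_ev_lap_ge (H _ _); last by rewrite subr_gt0).
- by move=> t _; rewrite /rdiff /=; ring.
- by move=> t _; rewrite /ldiff /=; ring.
Unshelve. all: by end_near. Qed.

Lemma LD_ge_idN a b x k : k < -1 -> LD_ge a b (\- id) x k.
Proof.
move=> k1.
have cid : continuous (id : R -> R) by move=> t; exact: cvg_id.
have H d : 0 < d -> ev_lap_ge (-1 \*o id) d k.
  move=> d0; rewrite /ev_lap_ge; near=> s.
  have s0 : 0 < s by near: s; exact: nbhs_pinfty_gt.
  rewrite lapZ // lap_id // mulN1r opprB.
  have : 0 <= (1 + s * d) * expR (- (s * d)).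
    by rewrite mulr_ge0 ?expR_ge0 // addr_ge0 // mulr_ge0 ?ltW.
  lra.
split=> xd; (apply: eq_ev_lap_ge (H _ _); last by rewrite subr_gt0).
- by move=> t _; rewrite /rdiff /=; ring.
- by move=> t _; rewrite /ldiff /=; ring.
Unshelve. all: by end_near. Qed.

End Derivates.

(** * Monotonicity from lower Laplace derivates *)

Section Monotonicity.
Context {R : realType}.
Implicit Types (G U W : R -> R) (a b c d e B s x : R).
Local Notation mu := (@lebesgue_measure R).

(** The cubic term of the exponential series beats [s ^+ 2] with a factor [s] to spare. *)
Lemma sqr_expRN_near_le d c : 0 < d -> 0 < c ->
  \forall s \near +oo, s ^+ 2 * expR (- (s * d)) <= c.
Proof.
move=> d0 c0; have d3 : 0 < d ^+ 3 by rewrite exprn_gt0.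
near=> s.
have s0 : 0 < s by near: s; exact: nbhs_pinfty_gt.
have : 6 / (c * d ^+ 3) <= s by near: s; apply: nbhs_pinfty_ge; exact: num_real.
rewrite ler_pdivrMr ?mulr_gt0 // => h6.
rewrite expRN ler_pdivrMr ?expR_gt0 //.
have := @expR_ge1Dxn _ (s * d) 2 (ltW (mulr_gt0 s0 d0)).
rewrite (_ : 3`!%:R = 6) // exprMn => h.
apply: le_trans (ler_wpM2l (ltW c0) h).
have := ler_wpM2l (sqr_ge0 s) h6.
have -> : s ^+ 2 * (s * (c * d ^+ 3)) = c * (s ^+ 3 * d ^+ 3) by ring.
rewrite mulrDr; lra.
Unshelve. all: by end_near. Qed.

(** Up to [e] the integrand is nonpositive; beyond [e] the weight is at most its value at [e]. Thus
    for large [s] only the sign of [G] near 0 matters. *)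
Lemma lap_near0_le G d e B s : continuous G -> 0 <= e <= d -> 0 <= s -> 0 <= B ->
  (forall t, 0 <= t <= e -> G t <= 0) ->
  (forall t, 0 <= t <= d -> G t <= B) ->
  lap G d s <= s ^+ 2 * expR (- (s * e)) * (B * d).
Proof.
move=> cG /andP[e0 ed] s0 B0 Ge Gd.
rewrite /lap -mulrA; apply: ler_wpM2l; first exact: sqr_ge0.
have -> : expR (- (s * e)) * (B * d) =
    \int[mu]_(t in `[0, d]) (expR (- (s * e)) * B).
  rewrite Rintegral_cst //= lebesgue_measure_itv /= lte_fin mulrA.
  case: ltP => [d0|d0]; first by rewrite oppr0 addr0.
  by rewrite (_ : d = 0) //; lra.
apply: le_Rintegral => //.
- exact: integrable_expRM.
- by apply: (@integrable_itv _ (cst _)); move=> t; exact: cvg_cst.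
move=> t; rewrite /= in_itv /= => /andP[t0 td].
case: (leP t e) => te.
  apply: (@le_trans _ _ 0); last by rewrite mulr_ge0 ?expR_ge0.
  by rewrite mulr_ge0_le0 ?expR_ge0 ?Ge ?t0.
apply: (@le_trans _ _ (expR (- (s * t)) * B)).
  by rewrite ler_wpM2l ?expR_ge0 // Gd ?t0.
by rewrite ler_wpM2r // ler_expR lerN2 ler_wpM2l // ltW.
Qed.

(** If [W d < W c], let [x0] be the last point of [[c, d]] where [W] is at least the mean [y] of
    these two values. Right of [x0], up to [d], the increments of [W] are nonpositive, so the right
    transform at [x0] cannot stay above [e]. *)
Lemma LD_gt0_nondecreasing a b W (e : R) : continuous W -> 0 < e ->
  (forall x, x \in `[a, b] -> LD_ge a b W x e) ->
  {in `[a, b] &, {homo W : y z / y <= z}}.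
Proof.
move=> cW e0 He c d; rewrite !in_itv /= => /andP[ac cb] /andP[ad db] cd.
rewrite leNgt; apply/negP => Wdc.
pose y := (W c + W d) / 2.
pose A := `[c, d]%classic `&` [set x | y <= W x].
have A0 : A !=set0.
  by exists c; split; rewrite /= ?in_itv /= ?lexx // /y; lra.
have cA : compact A.
  apply: compact_closedI; first exact: segment_compact.
  exact: (closed_comp (fun x _ => cW x) (@closed_ge _ y)).
have cid : {within A, continuous (id : R -> R)}.
  by apply: continuous_subspaceT => t; exact: cvg_id.
have [x0 /set_mem[]] := compact_EVT_max A0 cA cid.
rewrite /= in_itv /= => /andP[cx xd] yx maxx.
have {}xd : x0 < d.
  by rewrite lt_neqAle xd andbT; apply: contraTneq yx => ->; rewrite -ltNge /y; lra.
have Wx0 t : 0 <= t <= d - x0 -> rdiff W x0 t <= 0.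
  move=> /andP[t0 td]; rewrite /rdiff subr_le0.
  case: (ltgtP t 0) => [||->]; [lra| |by rewrite addr0].
  move=> {}t0; apply: le_trans yx; rewrite leNgt; apply/negP => yW.
  have : x0 + t <= x0; last by lra.
  by apply: maxx; apply/mem_set; split; rewrite /= ?in_itv /=; lra.
have ab : a <= b by lra.
have [m mab Wm] := EVT_max ab (continuous_subspaceT cW).
have x0ab : x0 \in `[a, b] by rewrite in_itv /=; lra.
pose B := W m - W x0.
have B0 : 0 <= B by rewrite subr_ge0 Wm.
have WB t : 0 <= t <= b - x0 -> rdiff W x0 t <= B.
  by move=> /andP[t0 tb]; rewrite lerB // Wm // in_itv /=; lra.
have Bb0 : 0 < B * (b - x0) + 1 by apply: ltr_wpDl => //; rewrite mulr_ge0 //; lra.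
have x0b : x0 < b by lra.
have dx0 : 0 < d - x0 by lra.
(* A bound by this quantity keeps the tail estimate below [e / 2]; the added 1 keeps the denominator
   positive even if [B = 0]. *)
have e' : 0 < e / 2 / (B * (b - x0) + 1) by rewrite !divr_gt0.
have small := sqr_expRN_near_le _ _ dx0 e'.
have [s [s0 [hs es]]] :
    exists s, 0 < s /\ s ^+ 2 * expR (- (s * (d - x0))) <= e / 2 / (B * (b - x0) + 1) /\
      e <= lap (rdiff W x0) (b - x0) s.
  near (pinfty_nbhs R) => s; exists s.
  split; first by near: s; exact: nbhs_pinfty_gt.
  by split; near: s => //; exact: (He x0 x0ab).1.
have := @lap_near0_le (rdiff W x0) (b - x0) (d - x0) B s.
move=> /(_ (continuous_rdiff _ _ cW)) -/(_ _ (ltW s0) B0 Wx0 WB) h.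
have {h} := le_trans es (h _).
have h2 := ler_wpM2r (ltW Bb0) hs; rewrite mulfVK ?gt_eqF // in h2.
have : 0 <= s ^+ 2 * expR (- (s * (d - x0))) by rewrite mulr_ge0 ?expR_ge0 ?sqr_ge0.
set E := s ^+ 2 * _ in h2 *; set F := B * _ in h2 *.
move=> E0 h; have : e <= E * F by apply: h; lra.
by move: h2; rewrite mulrDr; lra.
Unshelve. all: by end_near. Qed.

(** Adding a small positive slope makes the derivates strictly positive, which is the previous case;
    the slope then tends to 0. *)
Lemma LD_ge0_nondecreasing a b U : continuous U ->
  (forall x, x \in `[a, b] -> forall k, k < 0 -> LD_ge a b U x k) ->
  {in `[a, b] &, {homo U : y z / y <= z}}.
Proof.
move=> cU HU c d cab dab cd.
have cid : continuous (id : R -> R) by move=> t; exact: cvg_id.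
apply/ler_addgt0Pr => e e0.
have [->|] := eqVneq c d; first by rewrite lerDl ltW.
move=> cd'; have {}cd' : c < d by rewrite lt_neqAle cd'.
(* The slope whose increment from [c] to [d] is exactly [e]. *)
pose f := e / (d - c); have f0 : 0 < f by rewrite divr_gt0 // subr_gt0.
have fid : continuous (f \*o id) by move=> t; apply: cvgM; [exact: cvg_cst|exact: cvg_id].
have cW : continuous (U \+ (f \*o id)) by move=> t; apply: cvgD; [exact: cU|exact: fid].
have HW x : x \in `[a, b] -> LD_ge a b (U \+ (f \*o id)) x (f / 4).
  (* [U] contributes the negative bound [- (f / 4)], and the linear term half of its slope. *)
  move=> xab; have -> : f / 4 = - (f / 4) + f * (1 / 2) by field.
  apply: LD_geD => //; first by apply: HU => //; lra.
  by apply: LD_geZ => //; [exact: ltW|apply: LD_ge_id; lra].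
have f4 : 0 < f / 4 by lra.
have /= := LD_gt0_nondecreasing _ _ _ _ cW f4 HW _ _ cab dab cd.
have : f * d - f * c = e by rewrite -mulrBr /f mulfVK // subr_eq0 gt_eqF.
lra.
Qed.

End Monotonicity.

(** * Series of nonnegative continuous functions with dyadic bounds *)

Section DyadicSeries.
Context {R : realType}.
Implicit Types (x y : R).
Variables (T : nat -> R -> R) (e : R).
Hypothesis cT : forall n, continuous (T n).
Hypothesis T0 : forall n x, 0 <= T n x.
Hypothesis Te : forall n x, T n x <= e / 2 ^+ n.+1.

Let S n x := \sum_(i < n) T i x.

Definition dyadic_sum x := limn (S^~ x).

Let S_nondecreasing x : nondecreasing_seq (S^~ x).
Proof.
by apply/nondecreasing_seqP => n; rewrite /S big_ord_recr /= lerDl.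
Qed.

Let e_ge0 : 0 <= e.
Proof. by have := le_trans (T0 0 0) (Te 0 0); rewrite expr1; lra. Qed.

(** Each term is at most the drop of [e / 2 ^+ n] at its index, so [S n x + e / 2 ^+ n] is
    nonincreasing in [n]. *)
Let S_tail x n m : (n <= m)%N -> S m x <= S n x + e / 2 ^+ n.
Proof.
have /nonincreasing_seqP H (i : nat) :
    S i.+1 x + e / 2 ^+ i.+1 <= S i x + e / 2 ^+ i.
  have -> : e / 2 ^+ i = e / 2 ^+ i.+1 + e / 2 ^+ i.+1.
    by rewrite exprS; field; rewrite expf_neq0.
  by rewrite /S big_ord_recr /= addrA lerD2r lerD2l.
by move=> /H; apply: le_trans; rewrite lerDl divr_ge0 ?exprn_ge0.
Qed.

Let is_cvg_S x : cvgn (S^~ x).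
Proof.
apply: nondecreasing_is_cvgn => //; exists (S 0 x + e / 2 ^+ 0) => _ [n _ <-].
exact: S_tail.
Qed.

Let S_le_dyadic_sum n x : S n x <= dyadic_sum x.
Proof. exact: nondecreasing_cvgn_le. Qed.

Let dyadic_sum_le n x : dyadic_sum x <= S n x + e / 2 ^+ n.
Proof. by apply: limr_le => //; exists n => // m /= ?; exact: S_tail. Qed.

Let continuous_S n : continuous (S n).
Proof.
elim: n => [|n IH].
  by rewrite (_ : S 0 = cst 0); [move=> x; exact: cvg_cst|
    apply/funext => x; rewrite /S big_ord0].
rewrite (_ : S n.+1 = S n \+ T n); last by apply/funext => x; rewrite /S big_ord_recr.
by move=> x; apply: cvgD; [exact: IH|exact: cT].
Qed.

Lemma dyadic_sum_ge0 x : 0 <= dyadic_sum x.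
Proof. by apply: le_trans (S_le_dyadic_sum 0 x); rewrite /S big_ord0. Qed.

Lemma dyadic_sum_le_total x : dyadic_sum x <= e.
Proof.
by apply: le_trans (dyadic_sum_le 0 x) _; rewrite /S big_ord0 add0r expr0 divr1.
Qed.

Lemma continuous_dyadic_sum : continuous dyadic_sum.
Proof.
move=> x; apply/cvgrPdist_lt => eps eps0.
(* Since [N < 2 ^+ N], the remainder after [N] terms is below [eps / 2], uniformly in the point. *)
pose N := (Num.truncn (2 * e / eps)).+1.
have eN : e / 2 ^+ N < eps / 2.
  have : 2 * e / eps < 2 ^+ N.
    apply: lt_trans (truncnS_gt _) _.
    by rewrite -natrX ltr_nat ltn_expl.
  rewrite !ltr_pdivrMr ?exprn_gt0 //; lra.
have /cvgrPdist_lt/(_ (eps / 2)) := continuous_S N x.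
rewrite divr_gt0 // => /(_ isT); apply: filterS => y.
have := S_le_dyadic_sum N x; have := S_le_dyadic_sum N y.
have := dyadic_sum_le N x; have := dyadic_sum_le N y.
rewrite !ltr_norml => ? ? ? ? /andP[? ?]; apply/andP; split; lra.
Qed.

(** All other terms have nonnegative increments. Hence the sum with one term removed is still
    nondecreasing when all terms are. *)
Lemma dyadic_sum_increment m x y : (forall n, T n x <= T n y) ->
  T m y - T m x <= dyadic_sum y - dyadic_sum x.
Proof.
move=> Txy; suff : dyadic_sum x <= dyadic_sum y - (T m y - T m x) by lra.
apply: limr_le => //; exists m.+1 => // n /= mn.
have := S_le_dyadic_sum n y; suff : S n x + (T m y - T m x) <= S n y by lra.
rewrite /S (bigD1 (Ordinal mn)) //= [leRHS](bigD1 (Ordinal mn)) //=.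
have : \sum_(i < n | i != Ordinal mn) T i x <= \sum_(i < n | i != Ordinal mn) T i y.
  exact: ler_sum.
lra.
Qed.

End DyadicSeries.

(** * Upper values of the Laplace integral, null products and the mean value *)

Section LaplaceIntegral.
Context {R : realType}.
Variables (a b : R).
Hypothesis ab : a < b.
Implicit Types (f g h p U V : R -> R) (c e k x I J : R).

Let aab : a \in `[a, b]. Proof. by rewrite in_itv /= lexx ltW. Qed.
Let bab : b \in `[a, b]. Proof. by rewrite in_itv /= lexx ltW. Qed.

(** Retraction onto [[a, b]]: composing with it extends a function continuous on [[a, b]] to the
    whole line. *)
Definition clamp x := Num.max a (Num.min b x).

Lemma continuous_clamp : continuous clamp.
Proof.
move=> x; apply: continuous_max; first exact: cvg_cst.
by apply: continuous_min; [exact: cvg_cst|exact: cvg_id].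
Qed.

Lemma clamp_itv x : clamp x \in `[a, b].
Proof. by rewrite in_itv /= /clamp le_max lexx /= ge_max ltW //= ge_min lexx. Qed.

Lemma clamp_id x : x \in `[a, b] -> clamp x = x.
Proof.
by rewrite in_itv /= /clamp => /andP[ax xb]; rewrite min_r // max_r.
Qed.

Lemma clamp_nondecreasing : {homo clamp : x y / x <= y}.
Proof. by move=> x y xy; rewrite /clamp le_max2 // le_min2. Qed.

Lemma continuous_comp_clamp U :
  {within `[a, b], continuous U} -> continuous (U \o clamp).
Proof.
move=> /subspace_continuousP cU x A nA.
have near_clamp : \forall y \near x, `[a, b]%classic (clamp y) -> A (U (clamp y)).
  exact: continuous_clamp x _ (cU (clamp x) (clamp_itv x) A nA).
by apply: filterS near_clamp => y /= /(_ (clamp_itv y)).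
Qed.

(* The values of [f] are real, so [f x <= lowerLD a b U x] alone forces
   [-oo < lowerLD a b U x]. *)
Definition smooth_major f U :=
  continuous U /\ forall x, x \in `[a, b] -> forall k, k < f x -> LD_ge a b U x k.

Lemma major_smooth f U : major a b f U -> smooth_major f (U \o clamp).
Proof.
move=> [cU HU]; have cUc := continuous_comp_clamp _ cU; split=> // x xab k kf.
apply: lowerLD_gt => //; rewrite (@eq_in_lowerLD _ _ _ _ U) //.
  by apply: lt_le_trans (HU _ xab).1; rewrite lte_fin.
by move=> y yab; rewrite /= clamp_id.
Qed.

Lemma minor_smooth f V : minor a b f V -> smooth_major (\- f) (\- (V \o clamp)).
Proof.
move=> [cV HV]; have cVc := continuous_comp_clamp _ cV.
have cNVc : continuous (\- (V \o clamp)) by move=> t; apply: cvgN; exact: cVc.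
split=> // x xab k kf.
apply: lowerLD_gt => //; rewrite -[lowerLD _ _ _ _]oppeK -upperLDN //.
rewrite (@eq_in_upperLD _ _ _ _ V) // => [|y yab]; last by rewrite /= clamp_id.
rewrite lteNr; apply: le_lt_trans (HV _ xab).1 _.
by rewrite -EFinN lte_fin ltrNr.
Qed.

(* One half of integrability: some major functions of [f] have increments
   arbitrarily close to [I], or below it. *)
Definition upper_int f I := forall e, 0 < e ->
  exists2 U, smooth_major f U & U b - U a < I + e.

(** Minor functions enter negated, as major functions of [\- f]; the second half says that some have
    increments arbitrarily close to [I], or above it. *)
Definition is_lap_int f I := upper_int f I /\ upper_int (\- f) (- I).

Lemma is_lap_intP f :
  laplace_integrable a b f -> is_lap_int f (laplace_integral a b f).
Proof.
move=> [lu fin]; rewrite /laplace_integral; split=> e e0.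
  have [_ [U mU <-]] := lb_ereal_inf_adherent e0 fin.
  rewrite -/(lap_upper a b f) -[X in (_ < X + _)%E](fineK fin) -EFinD lte_fin => h.
  by exists (U \o clamp); [exact: major_smooth|rewrite /= !clamp_id].
have finl : lap_lower a b f \is a fin_num by rewrite lu.
have [_ [V mV <-]] := ub_ereal_sup_adherent e0 finl.
rewrite -/(lap_lower a b f) lu -[X in (X - _ < _)%E](fineK fin) -EFinB lte_fin => h.
exists (\- (V \o clamp)); first exact: minor_smooth.
by rewrite /= !clamp_id //; lra.
Qed.

Lemma upper_int_le f g I : {in `[a, b], forall x, g x <= f x} ->
  upper_int f I -> upper_int g I.
Proof.
move=> gf HI e /HI[U [cU HU] UI]; exists U => //; split=> // x xab k kg.
by apply: HU => //; apply: lt_le_trans kg (gf _ xab).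
Qed.

Lemma upper_intD f g I J : upper_int f I -> upper_int g J ->
  upper_int (f \+ g) (I + J).
Proof.
move=> HI HJ e e0; have e2 : 0 < e / 2 by rewrite divr_gt0.
have [U [cU HU] UI] := HI _ e2; have [V [cV HV] VJ] := HJ _ e2.
exists (U \+ V); last by rewrite /=; lra.
split=> [t|x xab k /= kfg]; first by apply: cvgD; [exact: cU|exact: cV].
(* The slack [f x + g x - k] is shared equally between the two summands. *)
have -> : k = (k + f x - g x) / 2 + (k - f x + g x) / 2 by field.
by apply: LD_geD => //; [apply: HU|apply: HV] => //; lra.
Qed.

Lemma smooth_majorZ c f U : 0 <= c ->
  smooth_major f U -> smooth_major (c \*o f) (c \*o U).
Proof.
move=> c0 [cU HU]; have c1 : 0 < c + 1 by lra.
split=> [t|x xab k /= kf]; first by apply: cvgM; [exact: cvg_cst|exact: cU].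
(* Dividing by [c + 1] treats [c = 0] uniformly; after scaling by [c] the loss is still at most
   [c * f x - k]. *)
have d0 : 0 < (c * f x - k) / (c + 1) by rewrite divr_gt0 // subr_gt0.
apply: (@LD_ge_le _ _ _ _ _ (c * (f x - (c * f x - k) / (c + 1)))).
  have : (c * f x - k) / (c + 1) * (c + 1) = c * f x - k by rewrite divfK ?gt_eqF.
  by set d := _ / _ in d0 *; nra.
by apply: LD_geZ => //; apply: HU => //; lra.
Qed.

(** Derivates on [[a, b]] ignore constants and outside values. This permits normalising [U] to
    vanish at [a] and, if it is monotone on [[a, b]], to be monotone everywhere. *)
Lemma smooth_major_clampD f U c :
  smooth_major f U -> smooth_major f (U \o clamp \+ cst c).
Proof.
move=> [cU HU]; have cc : continuous (cst c : R -> R) by move=> t; exact: cvg_cst.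
split=> [t|x xab k kf].
  apply: cvgD; last exact: cvg_cst.
  by apply: continuous_comp; [exact: continuous_clamp|exact: cU].
apply: (@eq_in_LD_ge _ _ _ (U \+ cst c)) => // [y yab|].
  by rewrite /= clamp_id.
rewrite -[k]addr0; apply: LD_geD => //; first exact: HU.
exact: LD_ge_nondecreasing.
Qed.

Lemma upper_intZ c f I : 0 <= c -> upper_int f I -> upper_int (c \*o f) (c * I).
Proof.
move=> c0 HI e e0; have c1 : 0 < c + 1 by lra.
have [U mU UI] := HI _ (divr_gt0 e0 c1).
exists (c \*o U); first exact: smooth_majorZ.
have : e / (c + 1) * (c + 1) = e by rewrite divfK ?gt_eqF.
have : 0 < e / (c + 1) by rewrite divr_gt0.
by rewrite /=; set d := e / _ in UI *; nra.
Qed.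

Lemma smooth_major_nondecreasing f U : {in `[a, b], forall x, 0 <= f x} ->
  smooth_major f U -> {in `[a, b] &, {homo U : x y / x <= y}}.
Proof.
move=> f0 [cU HU]; apply: LD_ge0_nondecreasing => // x xab k k0.
by apply: HU => //; apply: lt_le_trans k0 (f0 _ xab).
Qed.

Lemma upper_int_ge0 f I : {in `[a, b], forall x, 0 <= f x} ->
  upper_int f I -> 0 <= I.
Proof.
move=> f0 HI; apply/ler_addgt0Pr => e /HI[U mU UI].
have := smooth_major_nondecreasing _ _ f0 mU _ _ aab bab (ltW ab); lra.
Qed.

(** The sum [I + J] is an upper value for the zero function. This is the comparison between major
    and minor functions. *)
Lemma upper_int_opp_ge0 f I J : upper_int f I -> upper_int (\- f) J -> 0 <= I + J.
Proof.
move=> HI HJ; apply: upper_int_ge0 (upper_intD _ _ _ _ HI HJ) => x _ /=.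
by rewrite subrr.
Qed.

Lemma is_lap_intN f I : is_lap_int f I -> is_lap_int (\- f) (- I).
Proof.
move=> [HI HI']; split=> //; rewrite opprK.
by apply: upper_int_le HI => x _ /=; rewrite opprK.
Qed.

(** For negative [c] the multiple comes from scaling the upper value of [\- g] by [- c]. *)
Lemma upper_int_addZ f g I J c : is_lap_int f I -> is_lap_int g J ->
  upper_int (fun x => f x + c * g x) (I + c * J).
Proof.
move=> [If _] [Ig Ig'].
have [c0|c0] := leP 0 c; first exact: upper_intD If (upper_intZ _ _ _ c0 Ig).
have c0' : 0 <= - c by lra.
have -> : c * J = - c * - J by ring.
by apply: upper_int_le (upper_intD _ _ _ _ If (upper_intZ _ _ _ c0' Ig')) => x _ /=; lra.
Qed.

Lemma is_lap_int_cst1 : is_lap_int (fun=> 1) (b - a).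
Proof.
have cid : continuous (id : R -> R) by move=> t; exact: cvg_id.
split=> e e0.
  exists id; last by lra.
  by split=> // x xab k k1; exact: LD_ge_id.
exists (\- id); last by rewrite /=; lra.
split=> [t|x xab k k1]; first by apply: cvgN; exact: cid.
exact: LD_ge_idN.
Qed.


(* With [U_n] a major function of [h] of increment below [e / (n 2 ^ n)], the
   monotone series [\sum_n n (U_n - U_n a)] is a major function of [p h] for
   every [p], however large: at [x] a single term with [p x <= n] already
   suffices, the other terms being nondecreasing. *)
Lemma upper_int_mul0 h p : {in `[a, b], forall x, 0 <= h x} ->
  upper_int h 0 -> upper_int (p \* h) 0.
Proof.
move=> h0 Hh e e0.
have /choice[V HV] (n : nat) : exists V,
    smooth_major h V /\ V b - V a < e / 2 / 2 ^+ n.+1 / n.+1%:R.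
  (* The total is bounded by [e / 2] only weakly, and halving [e] restores the strict inequality
     required. *)
  have [|V mV] := Hh (e / 2 / 2 ^+ n.+1 / n.+1%:R).
    by rewrite !divr_gt0 ?exprn_gt0.
  by rewrite add0r => ?; exists V.
pose T n := n.+1%:R \*o (V n \o clamp \+ cst (- V n a)).
have mT n : smooth_major (n.+1%:R \*o h) (T n).
  by apply: smooth_majorZ => //; apply: smooth_major_clampD; exact: (HV n).1.
have ndT n : {homo T n : x y / x <= y}.
  move=> x y xy; rewrite /T /= ler_wpM2l // lerD2r.
  apply: (smooth_major_nondecreasing _ _ h0 (HV n).1); [exact: clamp_itv..|].
  exact: clamp_nondecreasing.
have le_clamp x : a <= clamp x <= b by have := clamp_itv x; rewrite in_itv.
have T0 n x : 0 <= T n x.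
  rewrite /T /= mulr_ge0 // subr_ge0.
  apply: (smooth_major_nondecreasing _ _ h0 (HV n).1) => //; first exact: clamp_itv.
  by have /andP[] := le_clamp x.
have Te n x : T n x <= e / 2 / 2 ^+ n.+1.
  rewrite /T /= mulrC -ler_pdivlMr //; apply: le_trans (ltW (HV n).2); rewrite lerD2r.
  apply: (smooth_major_nondecreasing _ _ h0 (HV n).1) => //; first exact: clamp_itv.
  by have /andP[] := le_clamp x.
have cT n : continuous (T n) := (mT n).1.
have cU := continuous_dyadic_sum _ _ cT T0 Te.
exists (dyadic_sum T).
  split=> // x xab k /= kph.
  (* [T N] carries the factor [N.+1], which exceeds [p x]; a negative [p x] truncates to 0. *)
  pose N := Num.truncn (p x).
  have pN : p x < N.+1%:R by exact: truncnS_gt.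
  have cNT : continuous (-1 \*o T N).
    by move=> t; apply: cvgM; [exact: cvg_cst|exact: cT].
  apply: (@eq_in_LD_ge _ _ _ (dyadic_sum T \+ (-1 \*o T N) \+ T N)) => //.
    by move=> y _ /=; ring.
  rewrite -[k]add0r; apply: LD_geD => //.
  - by move=> t; apply: cvgD; [exact: cU|exact: cNT].
  - apply: LD_ge_nondecreasing => // y z _ _ yz /=.
    have := @dyadic_sum_increment _ _ _ T0 Te N y z (fun n => ndT n _ _ yz).
    lra.
  - apply: (mT N).2 => //; apply: lt_le_trans kph _.
    by rewrite ler_wpM2r ?h0 // ltW.
have := @dyadic_sum_ge0 _ _ _ T0 Te a; have := @dyadic_sum_le_total _ _ _ T0 Te b; lra.
Qed.

Lemma exists_le_lap_mean f g I J : {in `[a, b], forall x, 0 <= g x} ->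
  is_lap_int g J -> 0 < J -> is_lap_int (fun x => f x * g x) I ->
  exists2 x, x \in `[a, b] & f x <= I / J.
Proof.
move=> g0 HJ J0 HI; apply: contrapT => nx.
have f_gt x : x \in `[a, b] -> I / J < f x.
  by move=> xab; rewrite ltNge; apply/negP => fx; apply: nx; exists x.
have := upper_int_addZ _ _ _ _ (- (I / J)) HI HJ.
rewrite mulNr divfK ?gt_eqF // subrr => Hh.
have h0 : {in `[a, b], forall x, 0 <= f x * g x + - (I / J) * g x}.
  move=> x xab; have := f_gt _ xab; have := g0 _ xab.
  by set c := I / J; nra.
have := upper_int_mul0 _ (fun x => (f x - I / J)^-1) h0 Hh.
have eg : {in `[a, b], forall x, g x <= (f x - I / J)^-1 * (f x * g x + - (I / J) * g x)}.
  move=> x xab; rewrite mulNr -mulrBl mulrA mulVf ?mul1r //.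
  by rewrite subr_eq0 gt_eqF // f_gt.
(* Now 0 is an upper value for [g], and [- J] is one for [\- g], so [0 <= - J], against [0 < J]. *)
by move=> /(upper_int_le _ _ _ eg) /upper_int_opp_ge0 /(_ HJ.2); lra.
Qed.

Lemma is_lap_int_mean f g I J : darboux_on a b f ->
  {in `[a, b], forall x, 0 <= g x} -> is_lap_int g J ->
  is_lap_int (fun x => f x * g x) I ->
  exists2 xi, xi \in `[a, b] & I = f xi * J.
Proof.
move=> df g0 HJ HI.
have := upper_int_ge0 _ _ g0 HJ.1; rewrite le_eqVlt => /predU1P[J0|J0].
  rewrite -J0 in HJ *; exists a => //; rewrite mulr0.
  (* The multipliers [f] and [\- f] of [g] yield [I <= 0] and [0 <= I] respectively. *)
  have [HI1 HI2] := HI; have [HJ1 _] := HJ.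
  have := upper_int_opp_ge0 _ _ _ (upper_int_mul0 _ f g0 HJ1) HI2.
  have nf : {in `[a, b], forall x, - (f x * g x) <= (\- f \* g) x}.
    by move=> x _ /=; rewrite mulNr.
  have := upper_int_opp_ge0 _ _ _ HI1 (upper_int_le _ _ _ nf (upper_int_mul0 _ (\- f) g0 HJ1)).
  lra.
have [x xab fx] := exists_le_lap_mean _ _ _ _ g0 HJ J0 HI.
have [y yab fy] : exists2 y, y \in `[a, b] & I / J <= f y.
  (* The opposite inequality is the same lemma applied to [- f]. *)
  have HN : is_lap_int (fun x => - f x * g x) (- I).
    by rewrite (_ : (fun _ => _) = \- (fun x => f x * g x)); [exact: is_lap_intN|
      apply/funext => z /=; rewrite mulNr].
  have [y yab] := exists_le_lap_mean _ _ _ _ g0 HJ J0 HN.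
  by rewrite mulNr lerN2; exists y.
have [z zab fz] : exists2 z, z \in `[a, b] & f z = I / J.
  have sub u v : u \in `[a, b] -> v \in `[a, b] -> {subset `[u, v] <= `[a, b]}.
    by rewrite !in_itv /= => ? ? z; rewrite !in_itv /= => ?; lra.
  have [xy|yx] := leP x y.
    have [|z zxy fz] := df x y (I / J) xab yab xy.
      by rewrite ge_min fx le_max fy orbT.
    by exists z => //; exact: sub zxy.
  have [|z zxy fz] := df y x (I / J) yab xab (ltW yx).
    by rewrite ge_min fx orbT le_max fy.
  by exists z => //; exact: sub zxy.
by exists z => //; rewrite fz divfK // gt_eqF.
Qed.

End LaplaceIntegral.

Theorem theorem8p1 (R : realType) (a b : R) (f g : R -> R) :
  a < b ->
  laplace_integrable a b f -> darboux_on a b f ->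
  laplace_integrable a b g -> (forall x, x \in `[a, b] -> 0 <= g x) ->
  laplace_integrable a b (fun x => f x * g x) ->
  (exists2 xi, xi \in `[a, b] &
     laplace_integral a b (fun x => f x * g x) = f xi * laplace_integral a b g) /\
  (exists2 xi, xi \in `[a, b] & laplace_integral a b f = f xi * (b - a)).
Proof.
move=> ab intf df intg g0 intfg; split.
  by apply: (is_lap_int_mean _ _ ab _ g); [..|exact: is_lap_intP|exact: is_lap_intP].
apply: (is_lap_int_mean _ _ ab _ (fun=> 1)) => //; first exact: is_lap_int_cst1.
rewrite (_ : (fun x => f x * 1) = f); first exact: is_lap_intP.
by apply/funext => x; rewrite mulr1.
Qed.
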